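(* Let $I$ be a non-trivial admissible ideal in $\mathbb{N}$ and let $x=\{x_k\}_{k\in\mathbb{N}}$ be an $I$-statistically bounded sequence of real numbers. Then for every $\varepsilon>0$ the set $$\{k\in\mathbb{N}:d(\Gamma_x^S(I),x_k)\ge\varepsilon\}$$ has $I$-asymptotic density zero, where $d(\Gamma_x^S(I),x_k)=\inf_{y\in\Gamma_x^S(I)}|y-x_k|$ is the distance from $x_k$ to the set $\Gamma_x^S(I)$.
   Context: $\mathbb{N}$ is the set of positive integers. An ideal $I$ in $\mathbb{N}$ is a class of subsets of $\mathbb{N}$ containing $\emptyset$ and closed under finite unions and under taking subsets; it is non-trivial if $\mathbb{N}\notin I$ and admissible if $\{n\}\in I$ for every $n\in\mathbb{N}$. A real sequence $\{a_n\}$ is $I$-convergent to $a$ ($I\text{-}\lim a_n=a$) if $\{n:|a_n-a|\ge\varepsilon\}\in I$ for every $\varepsilon>0$. For $K\subset\mathbb{N}$, the $I$-asymptotic density is $d_I(K)=I\text{-}\lim_{n\to\infty}\frac{|\{j\in K:j\le n\}|}{n}$, when this $I$-limit exists; $K$ has $I$-asymptotic density zero if $d_I(K)$ exists and equals $0$. ''$K$ does not have $I$-asymptotic density zero'' means that either $d_I(K)$ is positive or $d_I(K)$ does not exist. The sequence $x$ is $I$-statistically bounded if there exists $l>0$ with $d_I(\{k\in\mathbb{N}:|x_k|>l\})=0$ (equivalently, there is a compact set $C\subset\mathbb{R}$ with $d_I(\{k\in\mathbb{N}:x_k\notin C\})=0$). A real number $y$ is an $I$-statistical cluster point of $x$ if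 for every $\varepsilon>0$ the set $\{k\in\mathbb{N}:|x_k-y|<\varepsilon\}$ does not have $I$-asymptotic density zero; $\Gamma_x^S(I)$ is the set of all $I$-statistical cluster points of $x$. *)

(* Defs.v *)
From mathcomp Require Import all_boot all_order all_algebra.
From mathcomp Require Import finmap.
From mathcomp Require Import all_classical all_reals all_analysis.
Set Implicit Arguments.
Unset Strict Implicit.
Unset Printing Implicit Defensive.
Import Order.TTheory GRing.Theory Num.Theory.
Local Open Scope classical_set_scope.
Local Open Scope ring_scope.

Definition posint := {n : nat | (0 < n)%N}.

Record is_ideal (I : set (set posint)) : Prop := IsIdeal {
  ideal_set0 : I set0;
  ideal_setU : forall A B, I A -> I B -> I (A `|` B);
  ideal_subset : forall A B, A `<=` B -> I B -> I A }.

Definition nontrivial_ideal (I : set (set posint)) : Prop := ~ I setT.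

Definition admissible_ideal (I : set (set posint)) : Prop :=
  forall n : posint, I [set n].

Section ideal_statistics.
Context {R : realType}.
Implicit Types (I : set (set posint)) (K : set posint) (a x : posint -> R).

Definition ideal_cvg I a (l : R) : Prop :=
  forall e : R, 0 < e -> I [set n | e <= `|a n - l|].

Definition rel_freq K (n : posint) : R :=
  (#|` fset_set [set j : posint | K j /\ (val j <= val n)%N] |)%:R / (val n)%:R.

(* d_I(K) need not exist, so it is a relation between K and its value r. *)
Definition has_density I K (r : R) : Prop := ideal_cvg I (rel_freq K) r.

Definition density_zero I K : Prop := has_density I K 0.

Definition not_density_zero I K : Prop :=
  (exists2 r : R, 0 < r & has_density I K r) \/
  ~ (exists r : R, has_density I K r).

Definition stat_bounded I x : Prop :=
  exists2 l : R, 0 < l & density_zero I [set k | l < `|x k|].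

Definition stat_cluster_points I x : set R :=
  [set y | forall e : R, 0 < e -> not_density_zero I [set k | `|x k - y| < e]].

(* The infimum is taken in the extended reals: the distance to the empty set
   is +oo, not the value 0 of the real-valued inf. *)
Definition dist_set (A : set R) (z : R) : \bar R :=
  ereal_inf [set (`|y - z|)%:E | y in A].

End ideal_statistics.

(* Main.v *)
Require Import Defs.
From mathcomp Require Import all_boot all_order all_algebra.
From mathcomp Require Import finmap.
From mathcomp Require Import all_classical all_reals all_analysis.
Import Order.TTheory GRing.Theory Num.Theory.
Import numFieldNormedType.Exports.
Local Open Scope classical_set_scope.
Local Open Scope ring_scope.

(* The sets of density zero form an ideal Z.  If the exceptional set T were not
   in Z, the sets S of reals such that {k in T | x k \notin S} is in Z would form
   a proper filter containing `[- l, l], hence clustering at some z.  But z has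
   a neighbourhood U such that {k in T | x k \in U} is in Z: a small ball if z
   is not a cluster point of x, and the ball of radius e otherwise. *)

(** [fset_set] sends an infinite set to the empty one, so the counts in [rel_freq] can be compared
    only once these segments are known to be finite. *)
Lemma finite_initial_segment (K : set posint) (n : posint) :
  finite_set [set j : posint | K j /\ (val j <= val n)%N].
Proof.
have fin_le : finite_set [set m : nat | (m <= val n)%N].
  by apply: (sub_finite_set _ (finite_II (val n).+1)) => m /=; rewrite ltnS.
apply: (@sub_finite_set _ _ (val @^-1` [set m : nat | (m <= val n)%N])) => [j []//|].
by apply: finite_preimage => // i j _ _; apply: val_inj.
Qed.

Section density.
Local Set Implicit Arguments.
Local Unset Strict Implicit.
Context {R : realType}.
Implicit Types (I : set (set posint)) (K A B : set posint) (x : posint -> R).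

Lemma rel_freq_ge0 K n : 0 <= rel_freq K n :> R.
Proof. by rewrite /rel_freq divr_ge0. Qed.

Lemma rel_freq_set0 n : rel_freq set0 n = 0 :> R.
Proof.
rewrite /rel_freq (_ : [set _ | _] = set0) ?fset_set0 ?mul0r//.
by apply/seteqP; split => j // [].
Qed.

Lemma le_rel_freq A B n : A `<=` B -> rel_freq A n <= rel_freq B n :> R.
Proof.
move=> AB; rewrite /rel_freq ler_wpM2r ?invr_ge0 ?ler_nat//.
apply: fsubset_leq_card; rewrite -fset_set_sub; try exact: finite_initial_segment.
by move=> j [/AB].
Qed.

Lemma rel_freqU A B n : rel_freq (A `|` B) n <= rel_freq A n + rel_freq B n :> R.
Proof.
rewrite /rel_freq -mulrDl ler_wpM2r ?invr_ge0// -natrD ler_nat.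
rewrite (_ : [set j | (A `|` B) j /\ _] =
  [set j : posint | A j /\ (val j <= val n)%N] `|`
  [set j : posint | B j /\ (val j <= val n)%N]).
  rewrite fset_setU; try exact: finite_initial_segment.
  by rewrite cardfsU leq_subr.
apply/seteqP; split => j /=; first by move=> [[]]; [left|right].
by move=> [[? ?]|[? ?]]; split => //; [left|right].
Qed.

Lemma density_zero_sub I A B : is_ideal I -> A `<=` B ->
  density_zero (R := R) I B -> density_zero (R := R) I A.
Proof.
move=> hI AB zB e e0; apply: (ideal_subset hI) (zB e e0) => n /=.
by rewrite !subr0 !ger0_norm ?rel_freq_ge0// => /le_trans; apply; apply: le_rel_freq.
Qed.

(** Frequencies are subadditive: where that of the union reaches [e], one of the two summands
    reaches [e / 2]. *)
Lemma density_zeroU I A B : is_ideal I -> density_zero (R := R) I A ->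
  density_zero (R := R) I B -> density_zero (R := R) I (A `|` B).
Proof.
move=> hI zA zB e e0; have e20 : 0 < e / 2 by rewrite divr_gt0.
apply: (ideal_subset hI) (ideal_setU hI (zA _ e20) (zB _ e20)) => n /=.
rewrite !subr0 !ger0_norm ?rel_freq_ge0// => eAB.
have [?|Ae] := leP (e / 2) (rel_freq A n); [by left|right].
rewrite leNgt; apply/negP => Be.
have := le_lt_trans (le_trans eAB (rel_freqU A B n)) (ltrD Ae Be).
by rewrite -splitr ltxx.
Qed.

Lemma density_zero0 I : is_ideal I -> density_zero (R := R) I set0.
Proof.
move=> hI e e0; apply: (ideal_subset hI) (ideal_set0 hI) => n /=.
by rewrite rel_freq_set0 subr0 normr0 leNgt e0.
Qed.

(** Frequencies are nonnegative, so a negative [r] stays at distance at least [- r] from all of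
    them; the exceptional set for [- r] would be all of [posint]. *)
Lemma has_density_ge0 I K (r : R) :
  is_ideal I -> nontrivial_ideal I -> has_density I K r -> 0 <= r.
Proof.
move=> hI hnt dK; rewrite leNgt; apply/negP => r0; apply: hnt.
have Nr0 : 0 < - r by rewrite oppr_gt0.
apply: (ideal_subset hI) (dK _ Nr0) => n _ /=.
have rn := rel_freq_ge0 K n.
by rewrite ger0_norm ?lerDr// addr_ge0// ltW.
Qed.

(** [not_density_zero] asks for a positive density or none at all, so it complements [density_zero]
    only because negative densities are excluded. *)
Lemma density_zeroVnot I K : is_ideal I -> nontrivial_ideal I ->
  density_zero (R := R) I K \/ not_density_zero (R := R) I K.
Proof.
move=> hI hnt; have [[r dr]|] := pselect (exists r : R, has_density I K r);
  last by right; right.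
have := has_density_ge0 hI hnt dr; rewrite le_eqVlt => /orP[/eqP r0|r0].
  by left; rewrite /density_zero r0.
by right; left; exists r.
Qed.

Lemma not_stat_cluster_point I x y : is_ideal I -> nontrivial_ideal I ->
  ~ stat_cluster_points I x y ->
  exists2 d : R, 0 < d & density_zero (R := R) I [set k | `|x k - y| < d].
Proof.
move=> hI hnt; apply: contra_notP => noz d d0.
have [zd|//] := density_zeroVnot [set k | `|x k - y| < d] hI hnt.
by exfalso; apply: noz; exists d.
Qed.

(** A local-to-global principle: the neighbourhoods [U] may vary with [z] without any uniformity,
    and clustering of a filter stands in for a finite subcover. *)
Lemma density_zero_compact I x (C : set R) (T : set posint) : is_ideal I ->
  compact C -> density_zero (R := R) I (T `\` x @^-1` C) ->
  (forall z, C z ->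
    exists2 U, nbhs z U & density_zero (R := R) I (T `&` x @^-1` U)) ->
  density_zero (R := R) I T.
Proof.
move=> hI cC zC loc; apply: contrapT => nzT.
pose F : set_system R := fun S => density_zero (R := R) I (T `\` x @^-1` S).
have FF : ProperFilter F.
  split.
    (* Properness is exactly the assumption [nzT], since [F set0] says that [T] has density zero. *)
    by rewrite /F preimage_set0 setD0.
  split; rewrite /F.
  - by rewrite preimage_setT setDT; exact: density_zero0.
  - by move=> P Q zP zQ; rewrite preimage_setI setDIr; exact: density_zeroU.
  - move=> P Q PQ; apply: density_zero_sub => // k [Tk nQ]; split => //.
    by move=> /PQ.
have [z [Cz clz]] := cC F FF zC.
have [U Uz zU] := loc z Cz.
(* Removing the preimage of the complement of [U] from [T] leaves the part of [T] that [x] maps into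
   [U]. As [z] is a cluster point of [F], [U] would then meet its own complement. *)
have FU : F (~` U) by rewrite /F preimage_setC setDE setCK.
by have [t [nUt Ut]] := clz _ _ FU Uz.
Qed.

End density.

Theorem theorem3p6 (R : realType) (I : set (set posint)) (x : posint -> R)
    (hI : is_ideal I) (hnt : nontrivial_ideal I) (hadm : admissible_ideal I)
    (hx : stat_bounded I x) (e : R) (he : 0 < e) :
  @density_zero R I
    [set k : posint | (e%:E <= dist_set (stat_cluster_points I x) (x k))%E].
Proof.
have [l l0 zl] := hx.
apply: (@density_zero_compact R I x `[- l, l] _ hI (@segment_compact _ _ _)).
  apply: density_zero_sub zl => // k [_ /=].
  by rewrite in_itv /= -ler_norml => /negP; rewrite -ltNge.
move=> z _; have [Gz|nGz] := pselect (stat_cluster_points I x z).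
  exists (ball z e); first exact: nbhsx_ballx.
  (* The trace is empty here: [z] itself competes in the infimum, so [x k] in the ball would put the
     distance below [e]. *)
  apply: density_zero_sub (density_zero0 hI) => // k [/= ek xke].
  have : (e%:E <= `|z - x k|%:E)%E.
    by apply: le_trans ek _; apply: ereal_inf_lbound; exists z.
  by rewrite lee_fin leNgt => /negP; apply.
have [d d0 zd] := not_stat_cluster_point hI hnt nGz.
exists (ball z d); first exact: nbhsx_ballx.
by apply: density_zero_sub zd => // k [_] /=; rewrite -ball_normE /= distrC.
Qed.
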